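(* Let $\mathfrak{o}$ be a Fitting domain, let $n \in \mathbb{N}$, and let $\Lambda = M_{n\times n}(R)$ where $R$ is a commutative $\mathfrak{o}$-order (an $\mathfrak{o}$-order in a commutative separable algebra over the field of quotients of $\mathfrak{o}$), so that $\Lambda$ is both a Fitting order and a matrix ring over a commutative ring. Let $M$ be a finitely generated $\Lambda$-module. Then $$\mathrm{Fit}_{\Lambda}(M) = \mathrm{Fit}^{\max}_{\Lambda}(M).$$
   Context: Modules are left modules; $\zeta(\cdot)$ denotes the centre of a ring. A Fitting domain is an integrally closed complete commutative noetherian local domain $\mathfrak{o}$; let $F$ be its field of quotients. A Fitting order over $\mathfrak{o}$ is an $\mathfrak{o}$-order $\Lambda$ in a (finite dimensional) separable $F$-algebra $A$. The reduced norm $\mathrm{nr}: M_{b\times b}(A) \to \zeta(A)$ is defined componentwise on the simple components of $A$. Left-hand side: for $\Lambda = M_{n\times n}(R)$ with $R$ commutative, $\mathrm{Fit}_{\Lambda}(M) := \mathrm{Fit}_R(e_{11}M)$, where $e_{11}$ is the matrix with $1$ in position $(1,1)$ and $0$ elsewhere and $\mathrm{Fit}_R$ is the usual (zeroth) Fitting ideal over the commutative ring $R$. It is compared with $\mathrm{Fit}^{\max}_\Lambda(M) \subset \zeta(A)$ via the identification $R = \zeta(\Lambda)$. Right-hand side: for a Fitting order $\Lambda$ let $\mathcal{U}(\Lambda) := \langle \mathrm{nr}(H) \mid H \in \mathrm{GL}_b(\Lambda), b\in\mathbb{N}\rangle_{\zeta(\Lambda)} \subset \zeta(A)$, the $\zeta(\Lambda)$-span.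 For a finite presentation $\Lambda^a \xrightarrow{h} \Lambda^b \twoheadrightarrow M$, identify $h$ with a matrix in $M_{a\times b}(\Lambda)$ (acting by right multiplication on row vectors), let $S_b(h)$ be the set of its $b\times b$ submatrices when $a \ge b$, and put $\mathrm{Fit}_\Lambda(h) := \langle \mathrm{nr}(H) \mid H\in S_b(h)\rangle_{\mathcal{U}(\Lambda)}$ if $a\ge b$ and $\mathrm{Fit}_\Lambda(h) := 0$ if $a<b$. Then $\mathrm{Fit}^{\max}_\Lambda(M)$ is the unique maximal element with respect to inclusion (which exists) among all $\mathrm{Fit}_\Lambda(h)$, $h$ running through the finite presentations of $M$. *)

(* Defs.v *)
From HB Require Import structures.
From mathcomp Require Import all_boot all_order all_algebra all_field.
From mathcomp Require Import boolp classical_sets.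

Set Implicit Arguments.
Unset Strict Implicit.
Unset Printing Implicit Defensive.

Import GRing.Theory.
Local Open Scope classical_set_scope.
Local Open Scope ring_scope.

(* Finite sums of products s * x with s in S and x in X; when S is a subring
   this is the S-span of X, and for two ideals it is their product. *)
Definition span_over (A : nzRingType) (S X : set A) : set A :=
  [set z | exists k (s x : 'I_k -> A),
     (forall i, S (s i) /\ X (x i)) /\ z = \sum_i s i * x i].

Definition center (A : nzRingType) : set A :=
  [set z | forall a, a * z = z * a].

Section FittingDomains.
Variable R : comNzRingType.

Definition is_ideal (I : set R) : Prop :=
  [/\ I 0, forall x y, I x -> I y -> I (x + y) & forall a x, I x -> I (a * x)].

Definition is_maximal_ideal (m : set R) : Prop :=
  [/\ is_ideal m, ~ m 1 &
      forall J, is_ideal J -> m `<=` J -> ~ J 1 -> J = m].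

Definition noetherian : Prop :=
  forall I, is_ideal I ->
    exists k (g : 'I_k -> R), I = span_over setT (range g).

Definition is_local_with (m : set R) : Prop :=
  is_maximal_ideal m /\ forall m', is_maximal_ideal m' -> m' = m.

Fixpoint ideal_pow (I : set R) (k : nat) : set R :=
  if k is k'.+1 then span_over I (ideal_pow I k') else setT.

(* Complete in the sense R = lim R / I^k: separated, and Cauchy sequences for
   the I-adic topology converge. *)
Definition adically_complete (I : set R) : Prop :=
  (forall x, (forall k, ideal_pow I k x) -> x = 0) /\
  (forall u : nat -> R,
     (forall k, exists N, forall i j, (N <= i)%N -> (N <= j)%N ->
        ideal_pow I k (u i - u j)) ->
     exists l, forall k, exists N, forall i, (N <= i)%N ->
        ideal_pow I k (u i - l)).

End FittingDomains.

Definition integrally_closed (o : idomainType) : Prop :=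
  forall x : {fraction o}, integralOver (@tofrac o) x ->
    exists a : o, x = tofrac a.

Definition fitting_domain (o : idomainType) : Prop :=
  [/\ integrally_closed o, noetherian o &
      exists m : set o, is_local_with m /\ adically_complete m].

Definition is_simple_ring (B : nzRingType) : Prop :=
  forall I : set B,
    I 0 -> (forall x y, I x -> I y -> I (x + y)) ->
    (forall a x b, I x -> I (a * x * b)) ->
    I = [set 0] \/ I = setT.

(* A is the product of finitely many simple F-algebras whose centres (which
   are then fields) are separable field extensions of F. *)
Definition separable_algebra (F : fieldType) (A : falgType F) : Prop :=
  exists (k : nat) (B : 'I_k -> falgType F)
         (p : forall i, {lrmorphism A -> B i}),
    (forall y : (forall i, B i), exists! x : A, forall i, p i x = y i) /\
    (forall i, is_simple_ring (B i) /\
       forall z : B i, center z ->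
         exists q : {poly F}, separable_poly q /\ horner_alg z q = 0).

Definition is_order (o : idomainType) (A : falgType {fraction o})
    (S : set A) : Prop :=
  [/\ [/\ S 1, forall x y, S x -> S y -> S (x - y)
        & forall x y, S x -> S y -> S (x * y)],
      forall (c : o) x, S x -> S (tofrac c *: x),
      exists k (g : 'I_k -> A), (forall i, S (g i)) /\
        forall x, S x -> exists c : 'I_k -> o,
          x = \sum_i tofrac (c i) *: g i
    & forall x, exists k (c : 'I_k -> {fraction o}) (s : 'I_k -> A),
        (forall i, S (s i)) /\ x = \sum_i c i *: s i].

(* The simple components of a semisimple ring A are the rings e A, where e
   runs through the centrally primitive idempotents. *)
Definition centrally_primitive (A : nzRingType) (e : A) : Prop :=
  [/\ center e, e * e = e, e != 0 &
      forall f, center f -> f * f = f -> f * e = f -> f = 0 \/ f = e].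

(* The composite A -> e A -> E (x) e A = 'M_m(E) for a splitting field E of
   the simple component e A: the centre of e A acts by scalars, hence embeds
   in E, and the induced map E (x)_(centre) e A -> 'M_m(E) is onto; it is then
   bijective, since its source is simple. *)
Definition is_splitting (A : nzRingType) (e : A) (E : fieldType) (m : nat)
    (phi : {rmorphism A -> 'M[E]_m.+1}) : Prop :=
  [/\ phi e = 1, forall z, center z -> exists c : E, phi z = c%:M &
      forall B : 'M[E]_m.+1, exists k (c : 'I_k -> E) (a : 'I_k -> A),
        B = \sum_i c i *: phi (a i)].

(* A splitting of e A yields one of 'M_b(e A), sending H to the block matrix
   of the phi (H i j); its determinant is the component at e of nr H. *)
Definition is_reduced_norm (A : nzRingType) (b : nat) (H : 'M[A]_b) (z : A) :
    Prop :=
  center z /\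
  forall e : A, centrally_primitive e ->
  forall (E : fieldType) (m : nat) (phi : {rmorphism A -> 'M[E]_m.+1}),
    is_splitting e phi ->
    phi z = (\det (\mxblock_(i < b, j < b) phi (H i j)))%:M.

Definition nr (A : nzRingType) (b : nat) (H : 'M[A]_b) : A :=
  xget 0 (is_reduced_norm H).

Definition finitely_generated (L : nzRingType) (M : lmodType L) : Prop :=
  exists k (g : 'I_k -> M), forall x, exists c : 'I_k -> L,
    x = \sum_i c i *: g i.

(* h, acting by right multiplication on row vectors, is the first map of an
   exact sequence L^a -> L^b -> M -> 0. *)
Definition presents (L : nzRingType) (M : lmodType L) (a b : nat)
    (h : 'M[L]_(a, b)) : Prop :=
  exists p : {linear 'rV[L]_b -> M},
    (forall x, exists v, p v = x) /\
    (forall v, p v = 0 <-> exists u : 'rV[L]_a, v = u *m h).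

(* h' is obtained from h by keeping b of its rows. *)
Definition is_submatrix (L : Type) (a b : nat) (h : 'M[L]_(a, b))
    (h' : 'M[L]_b) : Prop :=
  exists f : 'I_b -> 'I_a,
    (forall i j : 'I_b, (i < j)%N -> (f i < f j)%N) /\ h' = rowsub f h.

Section CommutativeFitting.
Variable R : comNzRingType.

Definition minor_ideal (a b : nat) (h : 'M[R]_(a, b)) : set R :=
  if (b <= a)%N then
    span_over setT [set x | exists2 H, is_submatrix h H & x = \det H]
  else [set 0].

(* Does not depend on the presentation. *)
Definition Fit (N : lmodType R) : set R :=
  [set r | exists a b (h : 'M[R]_(a, b)), presents N h /\ minor_ideal h r].

End CommutativeFitting.

Section MaximalFitting.
(* L is a Fitting order in A, included through j. *)
Variables (L A : nzRingType) (j : {rmorphism L -> A}).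

Definition calU : set A :=
  span_over (j @` @center L)
    [set x | exists b (H H' : 'M[L]_b),
       [/\ H *m H' = 1%:M, H' *m H = 1%:M & x = nr (map_mx j H)]].

Definition Fit_pres (a b : nat) (h : 'M[L]_(a, b)) : set A :=
  if (b <= a)%N then
    span_over calU [set x | exists2 H, is_submatrix h H & x = nr (map_mx j H)]
  else [set 0].

Definition is_Fitting_invariant (M : lmodType L) (I : set A) : Prop :=
  exists a b (h : 'M[L]_(a, b)), presents M h /\ I = Fit_pres h.

Definition is_maximal_Fitting (M : lmodType L) (I : set A) : Prop :=
  is_Fitting_invariant M I /\
  forall J, is_Fitting_invariant M J -> I `<=` J -> J = I.

(* I is Fit^max(M): the unique maximal element. *)
Definition is_Fitmax (M : lmodType L) (I : set A) : Prop :=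
  is_maximal_Fitting M I /\ forall J, is_maximal_Fitting M J -> J = I.

End MaximalFitting.

Section MatrixRings.
Variables (R : comNzRingType) (n : nat).

Definition e11 : 'M[R]_n.+1 := delta_mx ord0 ord0.

Lemma e11_idem : e11 * e11 = e11.
Proof. by rewrite /e11 -mulmxE mul_delta_mx. Qed.

Variable M : lmodType 'M[R]_n.+1.

Definition e11_pred : {pred M} := [pred x | e11 *: x == x].

Lemma e11_predP x : reflect (exists y, x = e11 *: y) (x \in e11_pred).
Proof.
rewrite inE; apply: (iffP eqP) => [<-|[y ->]]; first by exists x.
by rewrite scalerA e11_idem.
Qed.

Record e11_part : Type := E11Part { e11_val : M; _ : e11_val \in e11_pred }.

HB.instance Definition _ := [isSub for e11_val].
HB.instance Definition _ := [Choice of e11_part by <:].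

Lemma e11_zmod_closed : zmod_closed e11_pred.
Proof.
split=> [|x y]; rewrite !inE ?scaler0 //.
by move=> /eqP ex /eqP ey; rewrite scalerBr ex ey.
Qed.

HB.instance Definition _ :=
  GRing.isZmodClosed.Build M e11_pred e11_zmod_closed.
HB.instance Definition _ := [SubChoice_isSubZmodule of e11_part by <:].

(* R acts through the scalar matrices. *)
Lemma e11_scale_subproof (r : R) (x : e11_part) :
  (r%:M : 'M[R]_n.+1) *: val x \in e11_pred.
Proof.
have /eqP ex := valP x; rewrite inE scalerA.
have -> : e11 * r%:M = r%:M * e11 by rewrite -!mulmxE scalar_mxC.
by rewrite -scalerA ex.
Qed.

Definition e11_scale (r : R) (x : e11_part) : e11_part :=
  E11Part (e11_scale_subproof r x).

Fact e11_scaleA a b x : e11_scale a (e11_scale b x) = e11_scale (a * b) x.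
Proof. by apply: val_inj; rewrite /= scalerA -mulmxE -scalar_mxM. Qed.

Fact e11_scale1 : left_id 1 e11_scale.
Proof. by move=> x; apply: val_inj; rewrite /= scale1r. Qed.

Fact e11_scaleDr : right_distributive e11_scale +%R.
Proof. by move=> a x y; apply: val_inj; rewrite /= scalerDr. Qed.

Fact e11_scaleDl x : {morph e11_scale^~ x : a b / a + b}.
Proof. by move=> a b; apply: val_inj; rewrite /= raddfD /= scalerDl. Qed.

HB.instance Definition _ := GRing.Zmodule_isLmodule.Build R e11_part
  e11_scaleA e11_scale1 e11_scaleDr e11_scaleDl.

End MatrixRings.

(* Fit of e11 M, viewed in the centre of 'M_n(C) through R = centre of
   'M_n(R). *)
Definition Fit_mx (R : comNzRingType) (C : nzRingType)
    (iota : {rmorphism R -> C}) (n : nat) (M : lmodType 'M[R]_n.+1) :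
    set 'M[C]_n.+1 :=
  [set map_mx iota r%:M | r in Fit (e11_part M)].

(* Main.v *)
Require Import Defs.
From HB Require Import structures.
From mathcomp Require Import all_boot all_order all_algebra all_field.
From mathcomp Require Import all_fingroup.
From mathcomp Require Import boolp classical_sets.

Set Implicit Arguments.
Unset Strict Implicit.
Unset Printing Implicit Defensive.

Import GRing.Theory.
Local Open Scope classical_set_scope.
Local Open Scope ring_scope.

(* Identify b x b matrices over 'M_n(R) with bn x bn matrices over R.  Every
   splitting of a simple component of 'M_n(C) is conjugate to the entrywise
   extension of a ring morphism from C to a field, so the reduced norm of a
   matrix over 'M_n(R) is the determinant of the underlying matrix over R.
   Hence Fit_pres h corresponds to the ideal of R spanned by the n-block minors
   of h, whereas Fit (e11 M) is spanned by the determinants of all square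
   matrices with rows in the kernel N of R^(bn) -> e11 M; this gives one
   inclusion for every h.  For the presentation whose rows are all n-tuples of
   generators of N, with enough repetitions, multilinearity of the determinant
   shows that the block minors span the whole of Fit (e11 M). *)

(** * Ideals and spans *)

Lemma is_ideal_sum (R : comNzRingType) (I : set R) (J : Type) (r : seq J)
    (P : pred J) (F : J -> R) :
  is_ideal I -> (forall i, P i -> I (F i)) -> I (\sum_(i <- r | P i) F i).
Proof. by case=> I0 ID _ IF; elim/big_ind: _. Qed.

Lemma span_over_gen (A : nzRingType) (S X : set A) (x : A) :
  S 1 -> X x -> span_over S X x.
Proof.
move=> S1 Xx; exists 1%N, (fun=> 1), (fun=> x).
by rewrite big_ord1 mul1r.
Qed.

Lemma span_over0 (A : nzRingType) (S X : set A) : span_over S X 0.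
Proof.
by exists 0%N, (fun=> 0), (fun=> 0); split; [case|rewrite big_ord0].
Qed.

Lemma is_ideal_span (R : comNzRingType) (X : set R) :
  is_ideal (span_over setT X).
Proof.
split=> [|x y|a x].
- exact: span_over0.
- move=> [k [s [u [Xu ->]]]] [l [t [v [Xv ->]]]].
  exists (k + l)%N,
    (fun i => match split i with inl j => s j | inr j => t j end),
    (fun i => match split i with inl j => u j | inr j => v j end).
  split; first by move=> i; case: (split i) => j; [apply: Xu|apply: Xv].
  rewrite big_split_ord /=; congr (_ + _); apply: eq_bigr => i _.
    by rewrite (unsplitK (inl i)).
  by rewrite (unsplitK (inr i)).
- move=> [k [s [u [Xu ->]]]]; exists k, (fun i => a * s i), u.
  split=> [i|]; first by case: (Xu i).
  by rewrite mulr_sumr; apply: eq_bigr => i _; rewrite mulrA.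
Qed.

Lemma span_over_sub (R : comNzRingType) (X I : set R) :
  is_ideal I -> X `<=` I -> span_over setT X `<=` I.
Proof.
move=> idI XI _ [k [s [x [Xx ->]]]]; apply: is_ideal_sum => // i _.
by case: idI => _ _; apply; apply/XI; case: (Xx i).
Qed.

(** * Determinants and Fitting's lemma *)

(** Multilinearity in the rows, each row of the product being a combination of rows of [G]. The sum
    runs over all maps [f], not only increasing ones, so neither sorting nor signs occur;
    [repeat_rows] realises every such [rowsub f G] as a submatrix. *)
Lemma det_mulmx_rowsub (R : comNzRingType) (b t : nat) (Y : 'M[R]_(b, t))
    (G : 'M[R]_(t, b)) :
  \det (Y *m G) =
  \sum_(f : {ffun 'I_b -> 'I_t}) (\prod_i Y i (f i)) * \det (rowsub f G).
Proof.
under [RHS]eq_bigr => f _ do rewrite /determinant mulr_sumr.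
rewrite exchange_big; apply: eq_bigr => /= s _.
under [RHS]eq_bigr => f _ do rewrite mulrCA -big_split.
rewrite -mulr_sumr; congr (_ * _).
under [RHS]eq_bigr => f _.
  under eq_bigr => i _ do rewrite mxE.
  over.
rewrite -(bigA_distr_bigA (fun i j => Y i j * G j (s i))) /=.
by apply: eq_bigr => i _; rewrite mxE.
Qed.

Lemma linear_lift (L : nzRingType) (N : lmodType L) (b b' : nat)
    (p : {linear 'rV[L]_b -> N}) (p' : {linear 'rV[L]_b' -> N}) :
  (forall x, exists v, p' v = x) ->
  exists T : 'M[L]_(b, b'), forall v, p v = p' (v *m T).
Proof.
move=> p'_onto; have [t tP] := choice (fun i => p'_onto (p (delta_mx 0 i))).
exists (\matrix_i t i) => v.
rewrite {1}[v]row_sum_delta mulmx_sum_row !linear_sum.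
by apply: eq_bigr => i _; rewrite !linearZ -tP rowK.
Qed.

(* Expanding along the first [b] columns leaves minors of [W]. *)
Lemma det_row_mx_ideal (R : comNzRingType) (I : set R) (b b' : nat)
    (K : set 'rV[R]_b') (V : 'M_(b + b', b)) (W : 'M_(b + b', b')) :
  is_ideal I ->
  (forall X : 'M_b', (forall i, K (row i X)) -> I (\det X)) ->
  (forall i, K (row i W)) -> I (\det (row_mx V W)).
Proof.
move=> idI KI; elim: b V W => [|b IHb] V W KW.
  by rewrite row_thin_mx; apply: KI.
rewrite (expand_det_col _ (lshift b' 0)); apply: is_ideal_sum => // i _.
have [_ _ IM] := idI; rewrite /cofactor mulrA; apply: IM.
rewrite col'Kl row'_row_mx; apply: IHb => k.
by rewrite row_rowsub.
Qed.

(* Fitting's lemma: in the coordinates of [p'], [\det X] becomes the determinant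
   of a larger matrix whose last [b'] columns have all rows in the kernel of
   [p']. *)
Lemma det_kernel_ideal (R : comNzRingType) (N : lmodType R) (I : set R)
    (b b' : nat) (p : {linear 'rV[R]_b -> N}) (p' : {linear 'rV[R]_b' -> N})
    (X : 'M_b) :
  is_ideal I ->
  (forall x, exists v, p v = x) -> (forall x, exists v, p' v = x) ->
  (forall X' : 'M_b', (forall i, p' (row i X') = 0) -> I (\det X')) ->
  (forall i, p (row i X) = 0) -> I (\det X).
Proof.
move=> idI p_onto p'_onto p'I pX.
have [T pT] := linear_lift p p'_onto; have [S p'S] := linear_lift p' p_onto.
(* All rows of [W] lie in the kernel of [p']: [p' (x *m T) = p x = 0] for a row [x] of [X], and
   [p' (v *m S *m T) = p (v *m S) = p' v]. *)
set W := col_mx (X *m T) (1%:M - S *m T).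
have -> : \det X = \det (row_mx (col_mx X (- S)) W).
  have -> : row_mx (col_mx X (- S)) W =
            block_mx X 0 (- S) 1%:M *m block_mx 1%:M T 0 1%:M.
    rewrite mulmx_block !mulmx1 !mulmx0 ?mul0mx !addr0 mulNmx.
    by rewrite [- _ + _]addrC block_mxEh.
  by rewrite det_mulmx det_lblock det_ublock !det1 !mulr1.
apply: (det_row_mx_ideal (K := [set v | p' v = 0])) => // i /=.
case: (splitP i) => j ij.
  have -> : i = lshift b' j by apply: val_inj.
  by rewrite rowKu row_mul -pT.
have -> : i = rshift b j by apply: val_inj.
rewrite rowKd linearB /= row_mul linearB /= -pT p'S row1.
by rewrite -rowE subrr.
Qed.

(** * Noetherian modules and orders *)

(** Induction on the rank: the first coordinates of elements of [K] form an ideal, and the elements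
    with first coordinate 0 form a submodule of smaller rank. The count [t.+1] keeps the index type
    of the generators nonempty, so that rows can be repeated later. *)
Lemma noetherian_submodule (R : comNzRingType) (k : nat) (K : set 'rV[R]_k) :
  noetherian R -> K 0 -> (forall u v, K u -> K v -> K (u + v)) ->
  (forall a v, K v -> K (a *: v)) ->
  exists t (G : 'M[R]_(t.+1, k)), forall v, K v <-> exists u, v = u *m G.
Proof.
move=> noeR; elim: k K => [|k IHk]; last rewrite -[k.+1]add1n.
all: move=> K K0 KD KZ.
  exists 0%N, 0 => v; split=> [_|_]; first by exists 0; rewrite thinmx0 mulmx0.
  by rewrite thinmx0.
pose I := [set a | exists v : 'rV[R]_k, K (row_mx a%:M v : 'rV_(1 + k))].
have idI : is_ideal I.
  split=> [|x y [u Ku] [v Kv]|a x [u Ku]].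
  - by exists 0; rewrite raddf0 row_mx0.
  - by exists (u + v); rewrite raddfD /= -add_row_mx; apply: KD.
  - by exists (a *: u); rewrite -scale_scalar_mx -scale_row_mx; apply: KZ.
have [s [g Ig]] := noeR I idI.
have {}IHk := IHk [set v | K (row_mx 0 v : 'rV_(1 + k))].
have [|u v Ku Kv|a v Kv|t [H KH]] := IHk.
- by rewrite /= row_mx0.
- by have := KD _ _ Ku Kv; rewrite /= add_row_mx addr0.
- by have := KZ a _ Kv; rewrite /= scale_row_mx scaler0.
have Igi i : exists v : 'rV[R]_k, K (row_mx (g i)%:M v : 'rV_(1 + k)).
  by have : I (g i) by rewrite Ig; apply: span_over_gen => //; exists i.
have [w Kw] := choice Igi.
pose G1 : 'M[R]_(s, 1 + k) := \matrix_i row_mx (g i)%:M (w i).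
have Ksum (J : finType) (c : J -> R) (F : J -> 'rV_(1 + k)) :
    (forall i, K (F i)) -> K (\sum_i c i *: F i).
  by move=> KF; elim/big_ind: _ => // i _; apply: KZ.
have KH' i : K (row i (row_mx 0 H : 'M_(t.+1, 1 + k))).
  rewrite row_row_mx row0; apply/KH; exists (delta_mx 0 i).
  by rewrite -rowE.
pose G : 'M[R]_((t + s).+1, 1 + k) := @col_mx _ t.+1 s _ (row_mx 0 H) G1.
have mulG u1 u2 : (@row_mx _ 1 t.+1 s u1 u2 : 'rV_(t + s).+1) *m G =
    u1 *m row_mx 0 H + u2 *m G1.
  exact: (@mul_row_col _ 1 t.+1 s (1 + k)).
exists (t + s)%N, G => v; split; last first.
  case=> u ->; rewrite -(@hsubmxK _ _ t.+1 s u) mulG.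
  apply: (KD : forall u v : 'rV_(1 + k), _).
    by rewrite mulmx_sum_row; apply: Ksum => i; apply: KH'.
  by rewrite mulmx_sum_row; apply: Ksum => i; rewrite rowK.
move=> Kv; pose v' : 'rV_(1 + k) := v.
have Iv : I (v' 0 0).
  exists (rsubmx v').
  suff -> : row_mx (v' 0 0)%:M (rsubmx v') = v' by [].
  rewrite -[RHS]hsubmxK; congr row_mx.
  by apply/rowP=> i; rewrite !mxE ord1 /=; congr (v' _ _); apply: val_inj.
have {Iv} [c vc] : exists c : 'rV_s, v' 0 0 = \sum_i c 0 i * g i.
  move: Iv; rewrite Ig => -[l [d [x [dx ->]]]].
  have gx i : exists j, g j = x i by have [_ [j _ jx]] := dx i; exists j.
  have [f fP] := choice gx.
  (* A combination in [span_over] may use a generator several times; its coefficients are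
     collected. *)
  exists (\row_j \sum_(i | f i == j) d i).
  rewrite (partition_big f predT) //=; apply: eq_bigr => j _.
  rewrite mxE mulr_suml; apply: eq_bigr => i /eqP <-.
  by rewrite fP.
(* Subtracting a combination of the lifted generators [G1] kills the first coordinate, so the
   induction hypothesis applies to the rest. *)
have : K (v' - c *m G1).
  apply: (KD : forall u v : 'rV_(1 + k), _) => //.
  rewrite -mulNmx mulmx_sum_row.
  by apply: Ksum => i; rewrite rowK.
have E : v' - c *m G1 = row_mx 0 (rsubmx (v' - c *m G1)).
  rewrite -[LHS]hsubmxK; congr row_mx; apply/rowP => i.
  rewrite !ord1 !mxE; apply/eqP; rewrite subr_eq0; apply/eqP.
  rewrite (_ : lshift _ 0 = 0) ?vc; last exact: val_inj.
  apply: eq_bigr => l _; congr (_ * _); rewrite !mxE.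
  by case: splitP => // -[[]] //= ? _; rewrite mxE ord1.
rewrite E; move/KH => [u vu]; exists (@row_mx _ 1 t.+1 s u c).
rewrite mulG mul_mx_row mulmx0 -vu.
by rewrite -E subrK.
Qed.

(** An ideal of [R] pulls back to a submodule of coefficient vectors in [S^t]; the images of
    finitely many generators of that submodule generate the ideal. *)
Lemma noetherian_finite (S R : comNzRingType) (s : {rmorphism S -> R}) (t : nat)
    (g : 'I_t -> R) :
  (forall x, exists c : 'I_t -> S, x = \sum_i s (c i) * g i) ->
  noetherian S -> noetherian R.
Proof.
move=> gen noeS I idI; have [I0 ID IM] := idI.
pose f (v : 'rV[S]_t) := \sum_i s (v 0 i) * g i.
have fD u v : f (u + v) = f u + f v.
  by rewrite -big_split; apply: eq_bigr => i _; rewrite mxE rmorphD mulrDl.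
have fZ a v : f (a *: v) = s a * f v.
  by rewrite mulr_sumr; apply: eq_bigr => i _; rewrite mxE rmorphM mulrA.
have f0 : f 0 = 0 by rewrite /f big1 // => i _; rewrite mxE rmorph0 mul0r.
have [||u v|a v|k [G KG]] := @noetherian_submodule S t [set v | I (f v)].
- by [].
- by rewrite /= f0.
- by rewrite /= fD; apply: ID.
- by rewrite /= fZ; apply: IM.
have IG i : I (f (row i G)).
  by apply/KG; exists (delta_mx 0 i); rewrite -rowE.
exists k.+1, (fun i => f (row i G)); apply/seteqP; split => x; last first.
  by apply: span_over_sub => // _ [i _ <-].
move=> Ix; have [c xc] := gen x.
have {}xc : x = f (\row_i c i).
  by rewrite xc; apply: eq_bigr => i _; rewrite mxE.
move: Ix; rewrite xc => /KG [u ->].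
have -> : f (u *m G) = \sum_i s (u 0 i) * f (row i G).
  rewrite mulmx_sum_row; elim/big_rec2: _ => [|i y1 y2 _ <-]; first exact: f0.
  by rewrite fD fZ.
apply: is_ideal_sum; first exact: is_ideal_span.
have [_ _ IM' i _] := is_ideal_span (range (fun i => f (row i G))).
by apply: IM'; apply: span_over_gen => //; exists i.
Qed.

(** Chosen preimages respect the ring operations because [iota] is injective. For an order this
    turns the structure map from [o] to [C] into one from [o] to [R]. *)
Lemma rmorphism_lift (S R C : nzRingType) (iota : {rmorphism R -> C})
    (f : {rmorphism S -> C}) :
  injective iota -> (forall c, exists r, iota r = f c) ->
  exists s : {rmorphism S -> R}, forall c, iota (s c) = f c.
Proof.
move=> inj /choice [s sP].
have sB : zmod_morphism s.
  by move=> x y; apply: inj; rewrite rmorphB !sP rmorphB.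
have sM : monoid_morphism s.
  split=> [|x y]; apply: inj; rewrite ?rmorphM ?rmorph1 !sP ?rmorphM //.
  by rewrite rmorph1.
pose aM := GRing.isZmodMorphism.Build _ _ s sB.
pose mM := GRing.isMonoidMorphism.Build _ _ s sM.
pose s' : {rmorphism S -> R} := HB.pack s aM mM.
by exists s'.
Qed.

Lemma noetherian_order (o : idomainType) (C : falgType {fraction o})
    (R : comNzRingType) (iota : {rmorphism R -> C}) :
  injective iota -> is_order (range iota) -> noetherian o -> noetherian R.
Proof.
move=> inj [[R1 _ _] RZ [k [g [Rg gen]]] _] noeo.
have [|s sP] := @rmorphism_lift o R C iota (in_alg C \o @tofrac o) inj.
  by move=> c /=; have [r _ <-] := RZ c _ R1; exists r.
have iota_g i : exists r, iota r = g i by have [r _ rE] := Rg i; exists r.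
have [g' g'P] := choice iota_g.
apply: (@noetherian_finite o R s k g') => // x.
have [|c xc] := gen (iota x); first by exists x.
exists c; apply: inj; rewrite xc rmorph_sum; apply: eq_bigr => i _.
by rewrite rmorphM sP g'P /= mulr_algl.
Qed.

(** * Splittings and the reduced norm *)

(** For [x != 0] the ideal of multiples of [x] is everything, hence contains 1. Commutativity is a
    mere hypothesis on [B], so the field structure is put on the same carrier and [f] is the
    identity. *)
Lemma commutative_simple_field (B : unitRingType) :
  (forall x y : B, x * y = y * x) -> is_simple_ring B ->
  exists (E : fieldType) (f : {rmorphism B -> E}), bijective f.
Proof.
move=> BC Bsimple.
have fieldB : forall x : B, x != 0 -> x \is a GRing.unit.
  move=> x x0; have [|y z [a ->] [b ->]|a y b [c ->]|x_0|xT] :=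
      Bsimple [set y | exists a, y = a * x].
  - by exists 0; rewrite mul0r.
  - by exists (a + b); rewrite mulrDl.
  - by exists (a * c * b); rewrite -!mulrA (BC x b).
  - case/eqP: x0; suff : [set y | exists a, y = a * x] x by rewrite x_0.
    by exists 1; rewrite mul1r.
  - have [a /esym ax] : [set y | exists a, y = a * x] 1 by rewrite xT.
    by apply/unitrP; exists a; rewrite [x * a]BC.
pose cM := GRing.PzRing_hasCommutativeMul.Build B BC.
pose B1 : comUnitRingType := HB.pack (GRing.UnitRing.sort B) cM.
pose fM := GRing.ComUnitRing_isField.Build B1 fieldB.
pose B2 : fieldType := HB.pack (GRing.ComUnitRing.sort B1) fM.
exists B2, (idfun : {rmorphism B -> B}); by exists id.
Qed.

(** An explicit Skolem-Noether argument: the images [f i j] of the matrix units satisfy the same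
    relations, and the spanning condition forces [F = f 0 0] to have rank one. Writing [F] as a
    column [u] times a row [v] up to a scalar, the columns [f i 0 *m u] and the rows [v *m f 0 j]
    assemble into [P] and [Q]. *)
Lemma splitting_conj (C : nzRingType) (n : nat) (E : fieldType) (m : nat)
    (phi : {rmorphism 'M[C]_n.+1 -> 'M[E]_m.+1}) :
  (forall c : C, exists d : E, phi c%:M = d%:M) ->
  (forall B : 'M[E]_m.+1, exists k (c : 'I_k -> E) (a : 'I_k -> 'M[C]_n.+1),
     B = \sum_i c i *: phi (a i)) ->
  exists (psi : {rmorphism C -> E}) (P : 'M[E]_(m.+1, n.+1))
      (Q : 'M[E]_(n.+1, m.+1)),
    [/\ P *m Q = 1%:M, Q *m P = 1%:M
      & forall X, phi X = P *m map_mx psi X *m Q].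
Proof.
move=> phi_scalar phi_span.
have phiM X Y : phi (X *m Y) = phi X *m phi Y by apply: (rmorphM phi).
pose psi0 c := phi c%:M 0 0.
have psi0E c : phi c%:M = (psi0 c)%:M.
  by have [d dE] := phi_scalar c; rewrite /psi0 dE mxE eqxx mulr1n.
have psiB : zmod_morphism psi0.
  by move=> x y; rewrite /psi0 !raddfB /= !mxE.
have psiM : monoid_morphism psi0.
  split=> [|x y]; first by rewrite /psi0 rmorph1 mxE.
  by rewrite /psi0 scalar_mxM phiM !psi0E -scalar_mxM !mxE eqxx.
pose aM := GRing.isZmodMorphism.Build _ _ psi0 psiB.
pose mM := GRing.isMonoidMorphism.Build _ _ psi0 psiM.
pose psi : {rmorphism C -> E} := HB.pack psi0 aM mM.
pose f i j : 'M[E]_m.+1 := phi (delta_mx i j).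
have fM i j k l : f i j *m f k l = f i l *+ (j == k).
  by rewrite -phiM mul_delta_mx_cond raddfMn.
have fMe i j l : f i j *m f j l = f i l by rewrite fM eqxx.
have phiE X : phi X = \sum_i \sum_j psi (X i j) *: f i j.
  rewrite [X in LHS]matrix_sum_delta raddf_sum; apply: eq_bigr => i _.
  rewrite raddf_sum; apply: eq_bigr => j _.
  transitivity (phi ((X i j)%:M *m delta_mx i j)).
    by rewrite mul_scalar_mx.
  by rewrite phiM psi0E mul_scalar_mx.
pose F := f 0 0.
have FF : F *m F = F by rewrite fMe.
have F_neq0 : F != 0.
  apply/eqP => F0; suff : phi 1 = 0.
    by rewrite rmorph1 => /eqP; rewrite oner_eq0.
  rewrite phiE big1 // => i _; rewrite big1 // => j _.
  have -> : f i j = f i 0 *m F *m f 0 j by rewrite !fMe.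
  by rewrite F0 mulmx0 mul0mx scaler0.
(* The corner cut out by [F] is one-dimensional: [F *m f i j *m F] vanishes unless [i = j = 0], and
   the image of [phi] spans all matrices. *)
have FXF B : exists d, F *m B *m F = d *: F.
  have [k [c [a ->]]] := phi_span B.
  exists (\sum_i c i * psi (a i 0 0)).
  rewrite mulmx_sumr mulmx_suml scaler_suml; apply: eq_bigr => i _.
  rewrite -scalemxAr -scalemxAl -scalerA; congr (_ *: _).
  rewrite phiE mulmx_sumr mulmx_suml (bigD1 0) //= [X in _ + X]big1 ?addr0.
    rewrite mulmx_sumr mulmx_suml (bigD1 0) //= [X in _ + X]big1 ?addr0.
      by rewrite -scalemxAr -scalemxAl !FF.
    move=> j /negPf j0; rewrite -scalemxAr -scalemxAl -mulmxA fM j0.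
    by rewrite mulmx0 scaler0.
  move=> j; rewrite eq_sym => /negPf j0.
  rewrite mulmx_sumr mulmx_suml big1 // => l _.
  by rewrite -scalemxAr -scalemxAl fM j0 mul0mx scaler0.
have [i0 [j0 d_neq0]] : exists i0 j0, F i0 j0 != 0.
  apply: contrapT => F0; case/eqP: F_neq0; apply/matrixP => i j; rewrite mxE.
  by apply/eqP; apply: contrapT => /negP Fij; apply: F0; exists i, j.
pose d := F i0 j0; pose u := col j0 F; pose v := row i0 F.
(* The product [u *m v] is [F] times a matrix unit times [F], hence a multiple of [F]; comparing
   entries at [(i0, j0)] identifies the factor as [d]. *)
have uv : u *m v = d *: F.
  have [d' d'E] := FXF (delta_mx j0 0 *m delta_mx (0 : 'I_1) i0).
  have uvE : u *m v = d' *: F by rewrite -d'E mulmxA -colE -mulmxA -rowE.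
  rewrite uvE; congr (_ *: _); apply: (mulIf d_neq0).
  have /matrixP/(_ i0 j0) := uvE.
  by rewrite !mxE big_ord1 !mxE => ->.
have vu : v *m u = d%:M.
  apply/matrixP => i j; rewrite !ord1.
  transitivity ((F *m F) i0 j0); last by rewrite FF mxE eqxx.
  by rewrite !mxE; apply: eq_bigr => k _; rewrite !mxE.
pose P : 'M[E]_(m.+1, n.+1) := \matrix_(k, i) (f i 0 *m u) k 0.
pose Q : 'M[E]_(n.+1, m.+1) := \matrix_(j, k) (d^-1 *: (v *m f 0 j)) 0 k.
have PYQ (Y : 'M[E]_n.+1) : P *m Y *m Q = \sum_i \sum_j Y i j *: f i j.
  have fE i j : f i j = (f i 0 *m u) *m (d^-1 *: (v *m f 0 j)).
    rewrite -scalemxAr -mulmxA (mulmxA u) uv -scalemxAl -scalemxAr scalerA.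
    by rewrite mulVf // scale1r !fMe.
  apply/matrixP => k l; rewrite summxE mxE.
  under eq_bigr => j _ do rewrite mxE mulr_suml.
  rewrite exchange_big; apply: eq_bigr => i _; rewrite summxE.
  apply: eq_bigr => j _; rewrite [in RHS]mxE fE [in RHS]mxE big_ord1.
  by rewrite [P k i]mxE [Q j l]mxE mulrCA mulrA.
have phiPQ X : phi X = P *m map_mx psi X *m Q.
  by rewrite PYQ phiE; do 2![apply: eq_bigr => ? _]; rewrite mxE.
exists psi, P, Q; split=> //.
  by have := phiPQ 1; rewrite rmorph1 map_mx1 mulmx1.
apply/matrixP => i j; rewrite [RHS]mxE.
transitivity ((d^-1 *: (v *m f 0 i) *m (f j 0 *m u)) 0 0).
  by rewrite !mxE; apply: eq_bigr => k _; rewrite [Q i k]mxE [P k j]mxE.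
rewrite -scalemxAl -mulmxA (mulmxA (f 0 i)) fM.
case: eqP => _; last by rewrite mul0mx mulmx0 scaler0 mxE.
rewrite (_ : F *m u = u) ?vu; last by rewrite /u colE mulmxA FF.
by rewrite !mxE eqxx mulVf.
Qed.

Lemma center_mxP (C : nzRingType) (n : nat) (X : 'M[C]_n.+1) :
  center X -> X = (X 0 0)%:M.
Proof.
move=> XC; apply/matrixP => i j; have := XC (delta_mx 0 i).
rewrite -!mulmxE => /matrixP/(_ 0 j).
rewrite !mxE (bigD1 i) //= mxE !eqxx mul1r big1 ?addr0; last first.
  by move=> k /negPf ki; rewrite mxE ki andbF mul0r.
move=> ->; rewrite (bigD1 0) //= mxE eqxx big1 ?addr0.
  by rewrite [j == i]eq_sym; case: eqP; rewrite ?mulr1 ?mulr0.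
by move=> k /negPf k0; rewrite mxE k0 mulr0.
Qed.

Lemma center_scalar_mx (C : nzRingType) (n : nat) (c : C) :
  center c -> center (c%:M : 'M[C]_n.+1).
Proof.
move=> cC X; apply/matrixP => i j; rewrite -!mulmxE mul_scalar_mx !mxE.
rewrite (bigD1 j) //= mxE eqxx big1 ?addr0 ?cC // => k /negPf kj.
by rewrite mxE kj mulr0.
Qed.

(** By [splitting_conj] the block matrix of a splitting is the flattened matrix over [E] multiplied
    by the block diagonal matrices of [P] and [Q], which are inverse to each other and cancel in the
    determinant. *)
Lemma is_reduced_norm_det (R : comNzRingType) (C : nzRingType)
    (iota : {rmorphism R -> C}) (n b : nat) (H : 'M['M[R]_n.+1]_b) :
  (forall x y : C, x * y = y * x) ->
  is_reduced_norm
    (map_mx (map_mx iota : {rmorphism 'M[R]_n.+1 -> 'M[C]_n.+1}) H)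
    (iota (\det (\mxblock_(i < b, j < b) H i j)))%:M.
Proof.
move=> CC; split=> [|e _ E m phi [phi1 phi_center phi_span]].
  by apply: center_scalar_mx => a; apply: CC.
have [|//|psi [P [Q [PQ QP phiE]]]] := @splitting_conj C n E m phi.
  by move=> c; apply: phi_center; apply: center_scalar_mx => a; apply: CC.
have [mn] : m.+1 = n.+1.
  by apply/eqP; rewrite eqn_leq (mulmx1_min PQ) (mulmx1_min QP).
subst m.
rewrite phiE map_scalar_mx mul_mx_scalar -scalemxAl PQ scalemx1; congr (_%:M).
pose D (X : 'M[E]_n.+1) := \mxdiag_(i < b) X.
have -> : \mxblock_(i < b, j < b) phi (map_mx (map_mx iota) H i j) =
    D P *m map_mx (psi \o iota) (\mxblock_(i < b, j < b) H i j) *m D Q.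
  have -> : map_mx (psi \o iota) (\mxblock_(i < b, j < b) H i j) =
      \mxblock_(i < b, j < b) map_mx (psi \o iota) (H i j).
    by apply/matrixP => i j; rewrite !mxE.
  rewrite mul_mxdiag_mxblock mul_mxblock_mxdiag; apply: eq_mxblock => i j.
  by rewrite phiE mxE -map_mx_comp.
rewrite !det_mulmx det_map_mx mulrAC -det_mulmx.
suff -> : D P *m D Q = 1%:M by rewrite det1 mul1r.
rewrite [D Q]/D /mxdiag mul_mxdiag_mxblock -(mxdiagZ 1).
apply: eq_mxblock => i j; case: eqP => _; last by rewrite mulmx0.
by rewrite !conform_mx_id.
Qed.

(** Since [nr] is a choice, this is what makes it computable. Central matrices are scalar and [C]
    embeds in the product of its components; each component is a field and provides a splitting that
    detects the corresponding coordinate. *)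
Lemma reduced_norm_unique (F : fieldType) (C : falgType F) (n b : nat)
    (H : 'M['M[C]_n.+1]_b) (z z' : 'M[C]_n.+1) :
  (forall x y : C, x * y = y * x) -> separable_algebra C ->
  is_reduced_norm H z -> is_reduced_norm H z' -> z = z'.
Proof.
move=> CC [k [B [p [prodC simpleB]]]] [zC zE] [z'C z'E].
have CCC (c : C) : center c by move=> a; exact: CC.
have p_inj x y : (forall i, p i x = p i y) -> x = y.
  move=> xy; have [w [_ wu]] := prodC (fun i => p i x).
  by rewrite -(wu x) // (wu y).
rewrite (center_mxP zC) (center_mxP z'C); congr (_%:M); apply: (p_inj) => i.
have pi_onto (y : B i) : exists x, p i x = y.
  have [x [xE _]] := prodC (dfwith (fun l => 0 : B l) y).
  by exists x; rewrite xE dfwith_in.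
have BC : forall x y : B i, x * y = y * x.
  move=> x y; have [[u <-] [v <-]] := (pi_onto x, pi_onto y).
  by rewrite -!rmorphM CC.
have [E [f f_bij]] := commutative_simple_field BC (proj1 (simpleB i)).
(* The idempotent of [C] that is 1 in component [i] and 0 elsewhere. *)
have [e [eP _]] := prodC (fun l => (l == i)%:R).
pose phi : {rmorphism 'M[C]_n.+1 -> 'M[E]_n.+1} := map_mx (f \o p i).
have split_phi : is_splitting (e%:M) phi.
  split.
  - by rewrite /phi /= map_scalar_mx /= eP eqxx rmorph1.
  - move=> w /center_mxP ->; exists (f (p i (w 0 0))).
    by rewrite /phi /= map_scalar_mx.
  - move=> Y; have [g gK fK] := f_bij.
    have [h hP] := choice pi_onto.
    exists 1%N, (fun=> 1), (fun=> map_mx (h \o g) Y); rewrite big_ord1 scale1r.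
    by apply/matrixP => r s; rewrite !mxE /= hP fK.
have e_prim : centrally_primitive (e%:M : 'M[C]_n.+1).
  split; first exact: center_scalar_mx.
  - rewrite -mulmxE -scalar_mxM; congr (_%:M); apply: p_inj => l.
    by rewrite rmorphM /= !eP -natrM mulnb andbb.
  - apply/eqP => /(congr1 phi); case: split_phi => -> _ _.
    by rewrite rmorph0 => /eqP; rewrite oner_eq0.
  - move=> w /center_mxP ->; set c := w 0 0.
    rewrite -!mulmxE -!scalar_mxM => /(congr1 (fun X : 'M_n.+1 => X 0 0)).
    rewrite !mxE eqxx !mulr1n => cc /(congr1 (fun X : 'M_n.+1 => X 0 0)).
    rewrite !mxE eqxx !mulr1n => ce.
    have pl0 l : l != i -> p l c = 0.
      by move=> /negPf li; rewrite -ce rmorphM /= eP li mulr0n mulr0.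
    (* An idempotent below [e] vanishes outside component [i], and in the field at [i] it can only
       be 0 or 1. *)
    have [fc0|fc1] : f (p i c) = 0 \/ f (p i c) = 1.
      have : f (p i c) * (f (p i c) - 1) = 0.
        by rewrite mulrBr mulr1 -!rmorphM cc subrr.
      by move/eqP; rewrite mulf_eq0 subr_eq0 => /orP[]/eqP; [left|right].
    + left; suff -> : c = 0 by rewrite raddf0.
      apply: p_inj => l; rewrite rmorph0; have [->|/pl0 //] := eqVneq l i.
      by apply: (bij_inj f_bij); rewrite rmorph0.
    + right; congr (_%:M); apply: p_inj => l; rewrite eP.
      have [->|/pl0 //] := eqVneq l i.
      by apply: (bij_inj f_bij); rewrite rmorph1.
have := zE _ e_prim E n phi split_phi.
rewrite -(z'E _ e_prim E n phi split_phi).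
by move/matrixP/(_ 0 0); rewrite !mxE /=; apply: (bij_inj f_bij).
Qed.

(** * Fitting invariants over matrix rings as block minors *)

(** Each retained row of [h] contributes [n.+1] rows over [R] at once, so in general only some of
    the maximal minors of the flattened matrix occur. *)
Definition block_minors (R : comNzRingType) (n a b : nat)
    (h : 'M['M[R]_n.+1]_(a, b)) : set R :=
  [set x | exists2 H, is_submatrix h H &
     x = \det (\mxblock_(i < b, j < b) H i j)].

Lemma nr_map_mx (F : fieldType) (R : comNzRingType) (C : falgType F)
    (iota : {rmorphism R -> C}) (n b : nat) (H : 'M['M[R]_n.+1]_b) :
  (forall x y : C, x * y = y * x) -> separable_algebra C ->
  nr (map_mx (map_mx iota : {rmorphism 'M[R]_n.+1 -> 'M[C]_n.+1}) H) =
  map_mx iota (\det (\mxblock_(i < b, j < b) H i j))%:M.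
Proof.
move=> CC sepC; rewrite map_scalar_mx.
have nrH := is_reduced_norm_det iota H CC.
apply: (reduced_norm_unique CC sepC _ nrH).
by apply: xgetPex; eexists; apply: nrH.
Qed.

(** Reduced norms of matrices over ['M_n.+1(R)] already lie in the image of [R], so the span adds
    nothing to the centre. *)
Lemma calU_mx (F : fieldType) (R : comNzRingType) (C : falgType F)
    (iota : {rmorphism R -> C}) (n : nat) :
  (forall x y : C, x * y = y * x) -> separable_algebra C ->
  calU (map_mx iota : {rmorphism 'M[R]_n.+1 -> 'M[C]_n.+1}) =
  range (fun r => map_mx iota r%:M).
Proof.
move=> CC sepC; apply/seteqP; split=> [_ [k [s [x [sx ->]]]]|_ [r _ <-]].
  have sxE i : exists r, s i * x i = map_mx iota r%:M.
    have [[z /center_mxP zE <-] [b [H [_ [_ _ ->]]]]] := sx i.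
    rewrite nr_map_mx // zE.
    exists (z 0 0 * \det (\mxblock_(i < b, j < b) H i j)).
    by rewrite -rmorphM /= -mulmxE -scalar_mxM.
  have [r rE] := choice sxE; exists (\sum_i r i) => //.
  by rewrite !raddf_sum; apply: eq_bigr => i _; rewrite rE.
exists 1%N, (fun=> map_mx iota r%:M), (fun=> 1).
split; last by rewrite big_ord1 mulr1.
move=> _; split.
  by exists r%:M => //; apply: center_scalar_mx => a; rewrite mulrC.
(* The empty matrix is invertible with reduced norm 1. *)
exists 0%N, 1%:M, 1%:M; rewrite mulmx1; split=> //.
rewrite nr_map_mx // -[LHS](rmorph1 (map_mx iota)).
rewrite (_ : \mxblock_(i, j) _ = 1%:M) ?det1 //.
by apply/matrixP => i; case: (tagnat.sig1 i).
Qed.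

Lemma Fit_pres_mx (F : fieldType) (R : comNzRingType) (C : falgType F)
    (iota : {rmorphism R -> C}) (n a b : nat) (h : 'M['M[R]_n.+1]_(a, b)) :
  (forall x y : C, x * y = y * x) -> separable_algebra C -> (b <= a)%N ->
  Fit_pres (map_mx iota : {rmorphism 'M[R]_n.+1 -> 'M[C]_n.+1}) h =
  [set map_mx iota r%:M | r in span_over setT (block_minors h)].
Proof.
move=> CC sepC ba; rewrite /Fit_pres ba calU_mx //.
have sumE k (r d : 'I_k -> R) : map_mx iota (\sum_i r i * d i)%:M =
    \sum_i map_mx iota (r i)%:M * map_mx iota (d i)%:M :> 'M[C]_n.+1.
  rewrite !raddf_sum; apply: eq_bigr => i _.
  by rewrite -rmorphM /= -mulmxE -scalar_mxM.
apply/seteqP; split=> [_ [k [s [x [sx ->]]]]|_ [_ [k [s [x [sx ->]]]] <-]].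
  have rE i : exists r, map_mx iota r%:M = s i.
    by have [[r _ rE] _] := sx i; exists r.
  have HE i : exists H, is_submatrix h H /\
      x i = map_mx iota (\det (\mxblock_(i < b, j < b) H i j))%:M.
    by have [_ [H hH ->]] := sx i; exists H; rewrite nr_map_mx.
  have [r rs] := choice rE; have [H Hx] := choice HE.
  exists (\sum_i r i * \det (\mxblock_(j < b, l < b) H i j l)).
    exists k, r, (fun i => \det (\mxblock_(j < b, l < b) H i j l)).
    split=> // i.
    by split=> //; exists (H i) => //; case: (Hx i).
  by rewrite sumE; apply: eq_bigr => i _; have [_ ->] := Hx i; rewrite rs.
exists k, (fun i => map_mx iota (s i)%:M), (fun i => map_mx iota (x i)%:M).
split; last exact: sumE.
move=> i; have [_ [H hH xE]] := sx i; split; first by exists (s i).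
by exists H => //; rewrite nr_map_mx // xE.
Qed.

(** * Presentations and the commutative Fitting ideal *)

Lemma row_submatrix_kernel (L : nzRingType) (M : lmodType L) (a b : nat)
    (p : {linear 'rV[L]_b -> M}) (h : 'M[L]_(a, b)) (H : 'M[L]_b) :
  (forall u, p (u *m h) = 0) -> is_submatrix h H -> forall i, p (row i H) = 0.
Proof. by move=> ph [f [_ ->]] i; rewrite row_rowsub rowE. Qed.

(* With enough copies of each row, a square matrix with arbitrary rows from
   [h] is a submatrix, its rows being in increasing order. *)
Lemma repeat_rows (L : nzRingType) (a b : nat) (h : 'M[L]_(a, b)) :
  (0 < a)%N ->
  exists c (h' : 'M[L]_(c, b)),
    [/\ (b <= c)%N,
        forall v, (exists u : 'rV_c, v = u *m h') <->
          (exists u : 'rV_a, v = u *m h)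
      & forall f : 'I_b -> 'I_a, is_submatrix h' (rowsub f h)].
Proof.
(* Index [k * a + i] stands for row [i] in copy [k]. Taking [b.+1] copies rather than [b] guarantees
   a copy 0 even when [b] is 0. *)
move=> a0; pose m (i : 'I_(b.+1 * a)) : 'I_a := Ordinal (ltn_pmod i a0).
have idx_lt (k : 'I_b.+1) (i : 'I_a) : (k * a + i < b.+1 * a)%N.
  apply: (@leq_trans (k.+1 * a)); last by rewrite leq_mul2r ltn_ord orbT.
  by rewrite mulSn addnC ltn_add2r.
pose idx k i := Ordinal (idx_lt k i).
have idxK k i : m (idx k i) = i.
  by apply: val_inj; rewrite /= modnMDl modn_small.
exists (b.+1 * a)%N, (rowsub m h); split=> [|v|f].
- by rewrite (leq_trans (leqnSn b)) // leq_pmulr.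
- split=> -[u ->].
    by exists (u *m rowsub m 1%:M); rewrite -mulmxA -rowsubE.
  exists (u *m rowsub (idx 0) 1%:M); rewrite -mulmxA -rowsubE -rowsub_comp.
  by congr (_ *m _); apply/matrixP => i j; rewrite mxE /= idxK.
(* The [k]-th row is taken from the [k]-th copy, so the indices increase whatever [f] is. *)
- exists (fun k => idx (widen_ord (leqnSn b) k) (f k)); split=> [i j ij /=|].
    apply: (@leq_trans (i.+1 * a)); first by rewrite mulSn addnC ltn_add2r.
    by rewrite (leq_trans _ (leq_addr _ _)) // leq_mul2r ij orbT.
  by apply/matrixP => i j; rewrite !mxE idxK.
Qed.

Definition kernel_dets (R : comNzRingType) (N : lmodType R) (b : nat)
    (p : {linear 'rV[R]_b -> N}) : set R :=
  [set x | exists2 X : 'M_b, forall i, p (row i X) = 0 & x = \det X].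

(** Fitting's lemma puts the minors of every presentation inside the right-hand side. Conversely,
    rows in the kernel are combinations of finitely many generators, and expanding the determinant
    leaves minors of the matrix of repeated generators. *)
Lemma Fit_kernel (R : comNzRingType) (N : lmodType R) (b : nat)
    (p : {linear 'rV[R]_b -> N}) :
  noetherian R -> (forall x, exists v, p v = x) ->
  Fit N = span_over setT (kernel_dets p).
Proof.
move=> noeR p_onto.
have kerP a c (h : 'M[R]_(a, c)) (q : {linear 'rV[R]_c -> N}) :
    (forall v, q v = 0 <-> exists u : 'rV_a, v = u *m h) ->
    forall u, q (u *m h) = 0.
  by move=> qh u; apply/qh; exists u.
apply/seteqP; split=> [r [a [c [h [[q [q_onto qh]]]]]]|].
  rewrite /minor_ideal; case: ifP => _; last first.
    by move=> ->; apply: span_over0.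
  apply: span_over_sub; first exact: is_ideal_span.
  move=> _ [H hH ->]; apply: (det_kernel_ideal (is_ideal_span _) q_onto p_onto).
    by move=> X pX; apply: span_over_gen => //; exists X.
  exact: row_submatrix_kernel (kerP _ _ _ _ qh) hH.
have [|u v|a v|t [G pG]] := @noetherian_submodule R b [set v | p v = 0] noeR.
- by rewrite /= linear0.
- by rewrite /= linearD => -> ->; rewrite addr0.
- by rewrite /= linearZ => /= ->; rewrite scaler0.
have [c [h [bc hG h_sub]]] := repeat_rows G (ltn0Sn t).
have sub : span_over setT (kernel_dets p) `<=` minor_ideal h.
  rewrite /minor_ideal bc.
  apply: span_over_sub; first exact: is_ideal_span.
  move=> _ [X pX ->].
  have XG i : exists u : 'rV_t.+1, row i X = u *m G by apply/pG; apply: pX.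
  have [Y YG] := choice XG.
  have -> : X = (\matrix_i Y i) *m G.
    by apply/row_matrixP => i; rewrite row_mul rowK YG.
  rewrite det_mulmx_rowsub; apply: is_ideal_sum; first exact: is_ideal_span.
  move=> f _; set D := [set x | _]; have [_ _ DM] := is_ideal_span D.
  apply: DM.
  by apply: span_over_gen => //; exists (rowsub f G).
move=> r /sub rh; exists c, b, h; split=> //; exists p; split=> // v.
by rewrite hG; apply: pG.
Qed.

(** * Morita correspondence for kernels *)

(** Vectors of length [b] over ['M_n.+1(R)] become wide matrices over [R] on which ['M_n.+1(R)] acts
    by left multiplication. The width is written as a sum to agree with the sizes of [\mxrow] and
    [\mxblock]. *)
Definition unflat_mx (R : comNzRingType) (n b : nat)
    (X : 'M[R]_(n.+1, \sum_(j < b) n.+1)) : 'rV['M[R]_n.+1]_b :=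
  \row_j submxrow X j.

Definition flat_mx (R : comNzRingType) (n b : nat) (x : 'rV['M[R]_n.+1]_b) :
    'M[R]_(n.+1, \sum_(j < b) n.+1) :=
  \mxrow_(j < b) (x 0 j : 'M[R]_n.+1).

Section FlatMatrices.
Variables (R : comNzRingType) (n b : nat).
Local Notation unflat_mx := (@unflat_mx R n b).

Lemma unflat_mx_is_zmod_morphism : zmod_morphism unflat_mx.
Proof.
move=> X Y; apply/rowP => j; rewrite !mxE.
by rewrite -submxrowN -submxrowD.
Qed.

HB.instance Definition _ := GRing.isZmodMorphism.Build _ _ unflat_mx
  unflat_mx_is_zmod_morphism.

Lemma unflat_mx_mulmx (A : 'M_n.+1) X : unflat_mx (A *m X) = A *: unflat_mx X.
Proof. by apply/rowP => j; rewrite !mxE -mulmxE mul_submxrow. Qed.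

Lemma unflat_mxK : cancel unflat_mx (@flat_mx R n b).
Proof.
move=> X; rewrite -[RHS]submxrowK; apply: eq_mxrow => j.
by rewrite mxE.
Qed.

Lemma flat_mxK : cancel (@flat_mx R n b) unflat_mx.
Proof. by move=> x; apply/rowP => j; rewrite mxE mxrowK. Qed.

End FlatMatrices.

Section E11Kernel.
Variables (R : comNzRingType) (n : nat) (M : lmodType 'M[R]_n.+1) (b : nat).
Variable p : {linear 'rV['M[R]_n.+1]_b -> M}.
Local Notation toprow w := (unflat_mx (delta_mx 0 (0 : 'I_1) *m w)).

Lemma e11_toprow (w : 'rV_(\sum_(j < b) n.+1)) :
  e11 R n *: (toprow w : 'rV_b) = toprow w.
Proof. by rewrite -unflat_mx_mulmx mulmxA mul_delta_mx. Qed.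

(** A vector [w] over [R], placed as the top row of an otherwise zero matrix, is fixed by [e11];
    hence [p] sends it into [e11 M]. *)
Lemma e11_presentation :
  exists q : {linear 'rV[R]_(\sum_(j < b) n.+1) -> e11_part M},
    forall w, val (q w) = p (toprow w).
Proof.
have q_in w : p (toprow w) \in @e11_pred R n M.
  by apply/e11_predP; exists (p (toprow w)); rewrite -linearZ e11_toprow.
pose q w : e11_part M := E11Part (q_in w).
have qB : zmod_morphism q.
  by move=> u v; apply: val_inj; rewrite /= mulmxBr !raddfB.
have qZ : scalable q.
  move=> a v; apply: val_inj; rewrite /= -linearZ -unflat_mx_mulmx.
  by rewrite mul_scalar_mx -scalemxAr.
pose aM := GRing.isZmodMorphism.Build _ _ q qB.
pose sM := GRing.isScalable.Build _ _ _ _ q qZ.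
pose q' : {linear 'rV[R]_(\sum_(j < b) n.+1) -> e11_part M} := HB.pack q aM sM.
by exists q'.
Qed.

Variable q : {linear 'rV[R]_(\sum_(j < b) n.+1) -> e11_part M}.
Hypothesis qE : forall w, val (q w) = p (toprow w).

Lemma e11_presentation_onto :
  (forall x, exists v, p v = x) -> forall x, exists w, q w = x.
Proof.
move=> p_onto x; have [v pv] := p_onto (val x).
exists (row 0 (flat_mx v)); apply: val_inj; rewrite qE rowE mulmxA mul_delta_mx.
by rewrite unflat_mx_mulmx flat_mxK linearZ pv; apply/eqP; apply: (valP x).
Qed.

(** Matrix units move row [i] of [X] to the top and back, so [X] and its rows generate each other
    over ['M_n.+1(R)]. *)
Lemma unflat_mx_kernel X : p (unflat_mx X) = 0 <-> forall i, q (row i X) = 0.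
Proof.
have rowE' i : toprow (row i X) = delta_mx 0 i *: unflat_mx X.
  by rewrite rowE mulmxA mul_delta_mx unflat_mx_mulmx.
split=> [pX i|qX].
  by apply: val_inj; rewrite qE rowE' linearZ /= pX scaler0.
have -> : unflat_mx X = \sum_i (delta_mx i 0 : 'M_n.+1) *: toprow (row i X).
  under eq_bigr => i _ do
    rewrite rowE' scalerA -mulmxE mul_delta_mx -unflat_mx_mulmx.
  rewrite -raddf_sum -mulmx_suml -[in LHS](mul1mx X) mx1_sum_delta.
  by [].
rewrite linear_sum big1 // => i _.
by rewrite linearZ /= -qE qX; apply: scaler0.
Qed.

End E11Kernel.

(** * The two inclusions and the maximal invariant *)

Lemma finitely_generated_onto (L : nzRingType) (M : lmodType L) :
  finitely_generated M ->
  exists k (p : {linear 'rV[L]_k -> M}), forall x, exists v, p v = x.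
Proof.
move=> [k [g gen]]; pose p (v : 'rV[L]_k) := \sum_i v 0 i *: g i.
have pB : zmod_morphism p.
  move=> u v; rewrite /p -sumrB; apply: eq_bigr => i _.
  by rewrite !mxE scalerBl.
have pZ : scalable p.
  move=> a v; rewrite /p scaler_sumr; apply: eq_bigr => i _.
  by rewrite mxE scalerA.
pose aM := GRing.isZmodMorphism.Build _ _ p pB.
pose sM := GRing.isScalable.Build _ _ _ _ p pZ.
pose p' : {linear 'rV[L]_k -> M} := HB.pack p aM sM.
exists k, p' => x; have [c ->] := gen x; exists (\row_i c i).
by apply: eq_bigr => i _; rewrite mxE.
Qed.

Lemma block_minors_sub_Fit (R : comNzRingType) (n : nat)
    (M : lmodType 'M[R]_n.+1) (a b : nat) (h : 'M['M[R]_n.+1]_(a, b)) :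
  noetherian R -> presents M h ->
  span_over setT (block_minors h) `<=` Fit (e11_part M).
Proof.
move=> noeR [p [p_onto pK]]; have [q qE] := e11_presentation p.
rewrite (Fit_kernel noeR (e11_presentation_onto qE p_onto)).
apply: span_over_sub; first exact: is_ideal_span.
move=> _ [H hH ->]; apply: span_over_gen => //.
(* Row [s] of the flattened matrix is row [tagnat.sig2 s] inside block row [tagnat.sig1 s], and each
   block row lies in the kernel of [p]. *)
exists (\mxblock_(i < b, j < b) H i j) => // s.
have pH : p (row (tagnat.sig1 s) H) = 0.
  by apply: (row_submatrix_kernel _ hH) => u; apply/pK; exists u.
rewrite -[row _ H]flat_mxK in pH.
have /(unflat_mx_kernel qE)/(_ (tagnat.sig2 s)) := pH.
by congr (q _ = 0); apply/rowP => t; rewrite !mxE.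
Qed.

Lemma Fit_sub_block_minors (R : comNzRingType) (n : nat)
    (M : lmodType 'M[R]_n.+1) :
  noetherian R -> finitely_generated M ->
  exists a b (h : 'M['M[R]_n.+1]_(a, b)),
    [/\ (b <= a)%N, presents M h
      & Fit (e11_part M) `<=` span_over setT (block_minors h)].
Proof.
move=> noeR /finitely_generated_onto [b [p p_onto]].
have [q qE] := e11_presentation p.
have [|u v|a v|t [G qG]] := @noetherian_submodule R _ [set v | q v = 0] noeR.
- by rewrite /= linear0.
- by rewrite /= linearD => -> ->; rewrite addr0.
- by rewrite /= linearZ => /= ->; rewrite scaler0.
(* One row of [h0] for each [n.+1]-tuple of generators of the kernel of [q], stacked into a wide
   matrix. *)
pose T : finType := {ffun 'I_n.+1 -> 'I_t.+1}.
pose h0 : 'M['M[R]_n.+1]_(#|T|, b) :=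
  \matrix_i unflat_mx (rowsub (enum_val i : T) G).
have T_gt0 : (0 < #|T|)%N by apply/card_gt0P; exists [ffun=> 0].
have [a [h [ba hh0 h_sub]]] := repeat_rows h0 T_gt0.
have ph0 i : p (row i h0) = 0.
  rewrite rowK; apply/(unflat_mx_kernel qE) => k; apply/qG.
  by rewrite row_rowsub rowE; exists (delta_mx 0 (enum_val i k : 'I_t.+1)).
exists a, b, h; split=> //.
  exists p; split=> // v; rewrite hh0; split=> [pv|[u ->]]; last first.
    rewrite mulmx_sum_row linear_sum big1 // => i _.
    by rewrite linearZ /= ph0 scaler0.
  have YG i : exists y : 'rV_t.+1, row i (flat_mx v) = y *m G.
    by apply/qG; move: i; apply/(unflat_mx_kernel qE); rewrite flat_mxK.
  have [Y YE] := choice YG.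
  (* The rows of [h0] indexed by constant tuples generate the kernel of [p]. *)
  pose c (s : 'I_t.+1) : T := [ffun=> s].
  exists (\sum_s diag_mx (\row_i Y i 0 s) *: delta_mx 0 (enum_rank (c s))).
  rewrite mulmx_suml; under eq_bigr => s _.
    rewrite -scalemxAl -rowE rowK enum_rankK -unflat_mx_mulmx.
    over.
  rewrite -raddf_sum -[LHS]flat_mxK; congr unflat_mx.
  apply/row_matrixP => i.
  rewrite YE mulmx_sum_row linear_sum; apply: eq_bigr => s _.
  by apply/rowP => j; rewrite mul_diag_mx !mxE ffunE.
rewrite (Fit_kernel noeR (e11_presentation_onto qE p_onto)).
apply: span_over_sub; first exact: is_ideal_span.
move=> _ [X qX ->].
have XG i : exists u : 'rV_t.+1, row i X = u *m G by apply/qG; apply: qX.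
have [Y YG] := choice XG.
have -> : X = (\matrix_i Y i) *m G.
  by apply/row_matrixP => i; rewrite row_mul rowK YG.
rewrite det_mulmx_rowsub; apply: is_ideal_sum; first exact: is_ideal_span.
move=> f _; have [_ _ DM] := is_ideal_span (block_minors h).
apply: DM; apply: span_over_gen => //.
(* The choice [f] of a generator for every flat row is cut into [b] tuples of length [n.+1], each
   indexing one row of [h0]. *)
pose F (k : 'I_b) := enum_rank ([ffun i => f (tagnat.Rank k i)] : T).
exists (rowsub F h0) => //; congr (\det _); apply/matrixP => k l.
by rewrite !mxE enum_rankK ffunE !tagnat.sig2K.
Qed.

Theorem proposition3p7 (o : idomainType) (C : falgType {fraction o})
    (R : comNzRingType) (iota : {rmorphism R -> C}) (n : nat)
    (M : lmodType 'M[R]_n.+1)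
    (ho : fitting_domain o)
    (hCcomm : forall x y : C, x * y = y * x)
    (hCsep : separable_algebra C)
    (hiota : injective iota)
    (hR : is_order (range iota))
    (hM : finitely_generated M) :
  is_Fitmax (map_mx iota : {rmorphism 'M[R]_n.+1 -> 'M[C]_n.+1}) M
    (Fit_mx iota M).
Proof.
have [_ noeo _] := ho.
have noeR := noetherian_order hiota hR noeo.
set j := (map_mx iota : {rmorphism _ -> _}).
have [a [b [h [ba Mh Fit_h]]]] := Fit_sub_block_minors noeR hM.
have sub_Fit J : is_Fitting_invariant j M J -> J `<=` Fit_mx iota M.
  move=> [a' [b' [h' [Mh' ->]]]].
  have [ba'|ab'] := leqP b' a'.
    rewrite (Fit_pres_mx iota h' hCcomm hCsep ba') => _ [r hr <-].
    by exists r => //; apply: (block_minors_sub_Fit noeR Mh').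
  rewrite /Fit_pres leqNgt ab' /= => _ ->; exists 0; last by rewrite !raddf0.
  by apply: (block_minors_sub_Fit noeR Mh'); apply: span_over0.
have Fit_inv : is_Fitting_invariant j M (Fit_mx iota M).
  exists a, b, h; split=> //; rewrite (Fit_pres_mx iota h hCcomm hCsep ba).
  apply/seteqP; split=> _ [r hr <-]; exists r => //; first exact: Fit_h.
  exact: (block_minors_sub_Fit noeR Mh).
(* An invariant containing all others is maximal, and any maximal one must equal it. *)
split; first by split=> // J Jinv FJ; apply/seteqP; split=> //; apply: sub_Fit.
move=> J [Jinv Jmax]; symmetry; apply: Jmax => //; exact: sub_Fit.
Qed.
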